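(* Let $R$ be a Euclidean domain with field of fractions $Q$, and let $m\colon \mathcal{F}\to\mathcal{G}$ be a morphism of Green functors with inflation (GFIs) over $R$, with kernel $\mathcal{K}$, such that $\mathcal{F}(H)$ is $R$-torsion free for all finite groups $H$. Let $G$ be a finite group such that for every normal subgroup $N$ of $G$ the inflation map $\mathrm{Inf}_{G/N}\colon\mathcal{F}(G/N)\to\mathcal{F}(G)$ is injective and the $R$-module $\mathcal{F}(G/N)$ is generated by $\mathcal{I}_{\mathcal{F}}(G/N)$ and $1_{\mathcal{F}(G/N)}$. Suppose that $G$ is primordial for $\mathcal{F}_Q$ and not primordial for $\mathrm{Im}\, m$. Let $\mathfrak{a}$ be the ideal of $R$ generated by all those $a\in R$ for which there exists a proper quotient $G/N$ of $G$ and an element $a1_{\mathcal{F}(G/N)}+y\in\mathcal{K}(G/N)$ with $y\in\mathcal{I}_{\mathcal{F}}(G/N)$. Then $\mathrm{Prim}_{\mathcal{K}}(G)$ is isomorphic to $R/\mathfrak{a}$ and is generated by the image of any element of the form $x=1_{\mathcal{F}(G)}+\sum_{H\lneq G}\mathrm{Ind}_{G/H}x_H\in\mathcal{K}(G)$, where $x_H\in\mathcal{F}(H)$.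
   Context: Rings are associative with a unit element. An $R$-algebra is a ring $A$ with a ring homomorphism from $R$ to the centre of $A$; homomorphisms preserve $1$. A proper quotient of $G$ is $G/N$ with $N\ne 1$ normal in $G$. A global Mackey functor with inflation (MFI) $\mathcal{F}$ over $R$ consists of: an $R$-module $\mathcal{F}(G)$ for every finite group $G$; an $R$-module homomorphism $\mathcal{F}_*(\alpha)\colon\mathcal{F}(H)\to\mathcal{F}(G)$ for every monomorphism $\alpha\colon H\to G$ of finite groups; an $R$-module homomorphism $\mathcal{F}^*(\epsilon)\colon\mathcal{F}(G)\to\mathcal{F}(H)$ for every homomorphism $\epsilon\colon H\to G$ of finite groups; such that: (MFI 1) $\mathcal{F}_*(\alpha\beta)=\mathcal{F}_*(\alpha)\mathcal{F}_*(\beta)$ for composable monomorphisms; (MFI 2) $\mathcal{F}^*(\alpha\beta)=\mathcal{F}^*(\beta)\mathcal{F}^*(\alpha)$ for composable homomorphisms; (MFI 3) $\mathcal{F}^*(\alpha)=\mathcal{F}_*(\alpha)=1$ for inner automorphisms $\alpha$; (MFI 4) $\mathcal{F}_*(\alpha)=\mathcal{F}^*(\alpha^{-1})$ for automorphisms $\alpha$; (MFI 5) for monomorphisms $\alpha\colon H\to G$, $\beta\colon K\to G$, $\mathcal{F}^*(\beta)\mathcal{F}_*(\alpha)=\sum_{g\in\alpha(H)\backslash G/\beta(K)}\mathcal{F}_*(\phi_g)\mathcal{F}^*(\psi_g)$, where $\phi_g\colon \alpha(H)\cap g\beta(K)g^{-1}\to K$ is $x\mapsto \beta^{-1}(g^{-1}xg)$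 and $\psi_g\colon\alpha(H)\cap g\beta(K)g^{-1}\to H$ is $x\mapsto\alpha^{-1}(x)$; (MFI 6) for every commutative square $\delta\alpha=\beta\epsilon$ with epimorphisms $\epsilon\colon H\to\bar H$, $\delta\colon G\to\bar G$ and monomorphisms $\alpha\colon H\to G$, $\beta\colon\bar H\to\bar G$ that is cartesian, i.e. $\alpha(H)=\delta^{-1}(\beta(\bar H))$, one has $\mathcal{F}^*(\delta)\mathcal{F}_*(\beta)=\mathcal{F}_*(\alpha)\mathcal{F}^*(\epsilon)$. For a subgroup $H\le G$ with inclusion $\alpha$, write $\mathrm{Ind}_{G/H}=\mathcal{F}_*(\alpha)$ and $\mathrm{Res}_{G/H}=\mathcal{F}^*(\alpha)$; for a normal subgroup $N$ with quotient map $\epsilon\colon G\to G/N$, write $\mathrm{Inf}_{G/N}=\mathcal{F}^*(\epsilon)$. A Green functor with inflation (GFI) over $R$ is an MFI $\mathcal{F}$ over $R$ such that each $\mathcal{F}(G)$ is an $R$-algebra, each $\mathcal{F}^*(\alpha)$ is an $R$-algebra homomorphism, and for every monomorphism $\alpha\colon H\to G$ and all $x\in\mathcal{F}(H)$, $y\in\mathcal{F}(G)$: $\mathcal{F}_*(\alpha)(x)\cdot y=\mathcal{F}_*(\alpha)(x\cdot\mathcal{F}^*(\alpha)(y))$ and $y\cdot\mathcal{F}_*(\alpha)(x)=\mathcal{F}_*(\alpha)(\mathcal{F}^*(\alpha)(y)\cdot x)$. A morphism $m\colon\mathcal{F}\to\mathcal{G}$ of GFIs is a collection of $R$-algebra homomorphisms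 $m_G\colon\mathcal{F}(G)\to\mathcal{G}(G)$, one for each finite group $G$, commuting with all $\mathcal{F}_*,\mathcal{G}_*$ and $\mathcal{F}^*,\mathcal{G}^*$. Its kernel $\mathcal{K}$, $\mathcal{K}(G)=\ker m_G$, and its image $\mathrm{Im}\,m$, $(\mathrm{Im}\,m)(G)=m_G(\mathcal{F}(G))$, carry the structure maps restricted from $\mathcal{F}$ and $\mathcal{G}$, respectively; $\mathcal{K}$ is an MFI and each $\mathcal{K}(G)$ is an ideal of $\mathcal{F}(G)$, and $\mathrm{Im}\,m$ is a GFI. $\mathcal{F}_Q=Q\otimes_R\mathcal{F}$ is the GFI over $Q$ given by $G\mapsto Q\otimes_R\mathcal{F}(G)$ with the base-changed structure maps. For an MFI $\mathcal{M}$, $\mathcal{I}_{\mathcal{M}}(G)=\sum_{H\lneq G}\mathrm{Ind}_{G/H}\mathcal{M}(H)$. A finite group $G$ is primordial for $\mathcal{M}$ if either $G$ is trivial or $\mathcal{M}(G)\neq\mathcal{I}_{\mathcal{M}}(G)$. Finally, $\mathrm{Imprim}_{\mathcal{K}}(G)=\sum_{H\lneq G}\mathrm{Ind}_{G/H}\mathcal{K}(H)+\sum_{1\neq N\trianglelefteq G}\mathrm{Inf}_{G/N}\mathcal{K}(G/N)\subseteq\mathcal{K}(G)$, and $\mathrm{Prim}_{\mathcal{K}}(G)$ is the $R$-module $\mathcal{K}(G)/\mathrm{Imprim}_{\mathcal{K}}(G)$. *)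

(* Defs.v *)
From HB Require Import structures.
From mathcomp Require Import ssreflect ssrfun ssrbool eqtype ssrnat seq choice.
From mathcomp Require Import fintype bigop finset.
From mathcomp Require Import fingroup morphism automorphism quotient.
From mathcomp Require Import ssralg generic_quotient ring_quotient fraction.
From mathcomp Require Import boolp.

Set Implicit Arguments.
Unset Strict Implicit.
Unset Printing Implicit Defensive.

Import GRing.Theory.
Local Open Scope ring_scope.

Definition euclidean_domain (R : idomainType) : Prop :=
  exists nu : R -> nat, forall a b : R, b != 0 ->
    exists q r : R, a = q * b + r /\ (r = 0 \/ (nu r < nu b)%N).

Definition torsion_free (R : idomainType) (V : lmodType R) : Prop :=
  forall (a : R) (v : V), a *: v = 0 -> a = 0 \/ v = 0.

Section SubModule.
Variables (R : pzRingType) (V : lmodType R) (S : submodClosed V).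

Record sub_mod : Type := SubMod { sub_mod_val : V; _ : sub_mod_val \in S }.

HB.instance Definition _ := [isSub for sub_mod_val].
HB.instance Definition _ := [Choice of sub_mod by <:].
HB.instance Definition _ := [SubChoice_isSubLmodule of sub_mod by <:].

End SubModule.

Section RestrictLinear.
Variables (R : pzRingType) (U V : lmodType R).
Variables (S : submodClosed U) (T : submodClosed V) (f : {linear U -> V}).
Hypothesis fST : forall u, u \in S -> f u \in T.

Definition restrict (x : sub_mod S) : sub_mod T := SubMod (fST (valP x)).

Lemma val_restrict x : val (restrict x) = f (val x).
Proof. by []. Qed.

Lemma restrict_is_linear : linear restrict.
Proof.
by move=> a x y; apply: val_inj; rewrite !linearP /= linearP.
Qed.

HB.instance Definition _ :=
  GRing.isLinear.Build R (sub_mod S) (sub_mod T) *:%R restrict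
    restrict_is_linear.

Definition restrict_lin : {linear sub_mod S -> sub_mod T} := restrict.

End RestrictLinear.

Section QuotientModule.
Variables (R : pzRingType) (V : lmodType R) (S : submodClosed V).

Definition submod_pred : {pred V} := S.

Fact submod_pred_closed : zmod_closed submod_pred.
Proof.
split=> [|x y xS yS]; first exact: rpred0.
by apply: rpredD => //; rewrite -scaleN1r rpredZ.
Qed.

HB.instance Definition _ :=
  GRing.isZmodClosed.Build V submod_pred submod_pred_closed.

Definition quot_mod : Type := Quotient.quot submod_pred.

HB.instance Definition _ := GRing.Zmodule.on quot_mod.

Definition quot_pi (v : V) : quot_mod := \pi_(Quotient.quot submod_pred)%qT v.

Lemma quot_pi_eq u v : quot_pi u = quot_pi v <-> u - v \in S.
Proof.
rewrite -[u - v \in S]/(u - v \in submod_pred) Quotient.idealrBE.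
by split=> [e|/eqP //]; apply/eqP.
Qed.

Lemma quot_pi_surj (x : quot_mod) : exists v, quot_pi v = x.
Proof. by exists (repr (x : Quotient.quot submod_pred)); rewrite /quot_pi reprK. Qed.

Lemma quot_piD u v : quot_pi (u + v) = quot_pi u + quot_pi v.
Proof. by rewrite /quot_pi !piE. Qed.

Definition quot_scale (a : R) (x : quot_mod) : quot_mod :=
  quot_pi (a *: repr (x : Quotient.quot submod_pred)).

Lemma quot_scale_pi a v : quot_scale a (quot_pi v) = quot_pi (a *: v).
Proof.
apply/quot_pi_eq; rewrite -scalerBr rpredZ //.
by apply/quot_pi_eq; rewrite /quot_pi reprK.
Qed.

Fact quot_scaleA a b x : quot_scale a (quot_scale b x) = quot_scale (a * b) x.
Proof.
by case: (quot_pi_surj x) => v <-; rewrite !quot_scale_pi scalerA.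
Qed.

Fact quot_scale1 : left_id 1 quot_scale.
Proof.
by move=> x; case: (quot_pi_surj x) => v <-; rewrite quot_scale_pi scale1r.
Qed.

Fact quot_scaleDr : right_distributive quot_scale +%R.
Proof.
move=> a x y; case: (quot_pi_surj x) => u <-; case: (quot_pi_surj y) => v <-.
by rewrite -quot_piD !quot_scale_pi scalerDr quot_piD.
Qed.

Fact quot_scaleDl x : {morph quot_scale^~ x : a b / a + b}.
Proof.
move=> a b; case: (quot_pi_surj x) => v <-.
by rewrite !quot_scale_pi scalerDl quot_piD.
Qed.

HB.instance Definition _ := GRing.Zmodule_isLmodule.Build R quot_mod
  quot_scaleA quot_scale1 quot_scaleDr quot_scaleDl.

End QuotientModule.

Section Span.
Variables (R : pzRingType) (V : lmodType R) (S : V -> Prop).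

Definition lin_span : {pred V} := fun v =>
  `[< exists2 s : seq (R * V),
        {in s, forall p, S p.2} & v = \sum_(p <- s) p.1 *: p.2 >].

Lemma lin_span_submod_closed : submod_closed lin_span.
Proof.
split; first by apply/asboolP; exists [::]; rewrite ?big_nil.
move=> a u v /asboolP[s sS ->] /asboolP[t tS ->]; apply/asboolP.
exists ([seq (a * p.1, p.2) | p <- s] ++ t).
  move=> p; by rewrite mem_cat => /orP[/mapP[q /sS Sq ->]|/tS].
rewrite big_cat big_map scaler_sumr; congr (_ + _).
by apply: eq_bigr => p _; rewrite scalerA.
Qed.

HB.instance Definition _ :=
  GRing.isSubmodClosed.Build R V lin_span lin_span_submod_closed.

End Span.

(** The library's [algType] excludes the zero ring, which may occur as a value
    of a Green functor. *)
Record ralgType (R : comPzRingType) := RAlg {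
  ralg_ring : pzRingType;
  ralg_map : {rmorphism R -> ralg_ring};
  ralg_central : forall (a : R) (x : ralg_ring),
    ralg_map a * x = x * ralg_map a
}.

Definition ralg_sort (R : comPzRingType) (A : ralgType R) : Type := ralg_ring A.
Coercion ralg_sort : ralgType >-> Sortclass.

Section AlgebraModule.
Variables (R : comPzRingType) (A : ralgType R).

HB.instance Definition _ := GRing.PzRing.copy (ralg_sort A) (ralg_ring A).

Definition ralg_scale (a : R) (x : A) : A := ralg_map A a * x.

Fact ralg_scaleA a b x : ralg_scale a (ralg_scale b x) = ralg_scale (a * b) x.
Proof. by rewrite /ralg_scale rmorphM mulrA. Qed.

Fact ralg_scale1 : left_id 1 ralg_scale.
Proof. by move=> x; rewrite /ralg_scale rmorph1 mul1r. Qed.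

Fact ralg_scaleDr : right_distributive ralg_scale +%R.
Proof. by move=> a x y; rewrite /ralg_scale mulrDr. Qed.

Fact ralg_scaleDl x : {morph ralg_scale^~ x : a b / a + b}.
Proof. by move=> a b; rewrite /ralg_scale rmorphD mulrDl. Qed.

HB.instance Definition _ := GRing.Zmodule_isLmodule.Build R (ralg_sort A)
  ralg_scaleA ralg_scale1 ralg_scaleDr ralg_scaleDl.

Definition ralg_lmod : lmodType R := ralg_sort A.

End AlgebraModule.

Notation hom G H := (@morphism G H [set: G]%g).

Record mono (H G : finGroupType) := Mono {
  mono_hom :> hom H G;
  mono_inj : ('injm mono_hom)%g
}.

Definition epi (G H : finGroupType) (f : hom G H) : Prop :=
  (f @* [set: G] = [set: H])%g.

Section Composition.
Variables G H K : finGroupType.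

Fact comp_homM (f : hom H K) (g : hom G H) :
  {in [set: G] &, {morph f \o g : x y / (x * y)%g}}.
Proof. by move=> x y _ _; rewrite /= !morphM ?inE. Qed.

Definition comp_hom (f : hom H K) (g : hom G H) : hom G K :=
  Morphism (comp_homM f g).

Fact comp_mono_inj (f : mono H K) (g : mono G H) : ('injm (comp_hom f g))%g.
Proof.
apply/injmP => x y _ _ /= /(injmP (mono_inj f)) e.
by apply: (injmP (mono_inj g)); rewrite ?inE // e ?inE.
Qed.

Definition comp_mono (f : mono H K) (g : mono G H) : mono G K :=
  Mono (comp_mono_inj f g).

End Composition.

Definition inner (G : finGroupType) (g : G) : mono G G :=
  Mono (injm_conj [set: G]%G g).

Definition incl (G : finGroupType) (H : {group G}) : mono (subg_of H) G :=
  Mono (injm_sgval H).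

Record normal_subgroup (G : finGroupType) := NormalSubgroup {
  nsub_group :> {group G};
  _ : (nsub_group <| [set: G])%g
}.

HB.instance Definition _ (G : finGroupType) :=
  [isSub for @nsub_group G].
HB.instance Definition _ (G : finGroupType) :=
  [Finite of normal_subgroup G by <:].

Section QuotientHom.
Variables (G : finGroupType) (N : normal_subgroup G).

Fact quo_homM : {in [set: G] &, {morph coset N : x y / (x * y)%g}}.
Proof.
have sGN := normal_norm (valP N).
by move=> x y _ _; apply: coset_morphM; apply: (subsetP sGN); rewrite inE.
Qed.

Definition quo_hom : hom G (coset_of N) := Morphism quo_homM.

End QuotientHom.

Section DoubleCosets.
Variables (H K G : finGroupType) (a : mono H G) (b : mono K G).

Definition img (L : finGroupType) (c : hom L G) : {group G} :=
  (c @* [set: L])%G.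

(** The double cosets [a(H) g b(K)]. *)
Definition dcosets : {set {set G}} :=
  [set (img a :* g * img b)%g | g in [set: G]%g].

Definition mackey_group (g : G) : {group G} := (img a :&: img b :^ g^-1)%G.

Fact mackey_lM g : {in [set: subg_of (mackey_group g)] &,
  {morph (fun x => invm (mono_inj a) (sgval x)) : x y / (x * y)%g}}.
Proof.
move=> x y _ _; rewrite /= morphM //.
- by case/setIP: (subgP x).
- by case/setIP: (subgP y).
Qed.

Fact mackey_l_inj g : ('injm (Morphism (@mackey_lM g)))%g.
Proof.
apply/injmP => x y _ _ /= e; apply: val_inj.
apply: (injmP (injm_invm (mono_inj a))) e.
- by case/setIP: (subgP x).
- by case/setIP: (subgP y).
Qed.

(** [x |-> a^-1 x], for [x] in [a(H) :&: g b(K) g^-1]. *)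
Definition mackey_l (g : G) : mono (subg_of (mackey_group g)) H :=
  Mono (@mackey_l_inj g).

Fact mackey_memr g (x : subg_of (mackey_group g)) :
  (sgval x ^ g)%g \in img b.
Proof. by case/setIP: (subgP x) => _; rewrite mem_conjgV. Qed.

Fact mackey_rM g : {in [set: subg_of (mackey_group g)] &,
  {morph (fun x => invm (mono_inj b) (sgval x ^ g)%g) : x y / (x * y)%g}}.
Proof. by move=> x y _ _; rewrite /= conjMg morphM // mackey_memr. Qed.

Fact mackey_r_inj g : ('injm (Morphism (@mackey_rM g)))%g.
Proof.
apply/injmP => x y _ _ /= e; apply: val_inj; apply: (conjg_inj g).
by apply: (injmP (injm_invm (mono_inj b))) e; apply: mackey_memr.
Qed.

(** [x |-> b^-1 (g^-1 x g)]; recall that [x ^ g] is [g^-1 * x * g]. *)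
Definition mackey_r (g : G) : mono (subg_of (mackey_group g)) K :=
  Mono (@mackey_r_inj g).

End DoubleCosets.

(** [mfi M] is the type of MFI structures on the family of modules [M]. *)
Record mfi (R : comPzRingType) (M : finGroupType -> lmodType R) := MFI {
  push : forall H G : finGroupType,
    mono H G -> {linear M H -> M G};
  pull : forall H G : finGroupType,
    hom H G -> {linear M G -> M H};
  push_comp : forall (H K G : finGroupType) (a : mono K G) (b : mono H K) x,
    push (comp_mono a b) x = push a (push b x);
  pull_comp : forall (H K G : finGroupType) (a : hom K G) (b : hom H K) x,
    pull (comp_hom a b) x = pull b (pull a x);
  pull_inner : forall (G : finGroupType) (g : G) x, pull (inner g) x = x;
  push_inner : forall (G : finGroupType) (g : G) x, push (inner g) x = x;
  push_aut : forall (G : finGroupType) (a b : mono G G),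
    cancel a b -> cancel b a -> forall x, push a x = pull b x;
  mackey : forall (H K G : finGroupType) (a : mono H G) (b : mono K G)
      (X : {set G}),
    is_transversal X (dcosets a b) [set: G]%g -> forall x,
    pull b (push a x) =
      \sum_(g in X) push (mackey_r a b g) (pull (mackey_l a b g) x);
  pull_push_cartesian : forall (H H' G G' : finGroupType)
      (e : hom H H') (d : hom G G') (a : mono H G) (b : mono H' G'),
    epi e -> epi d -> (forall x, d (a x) = b (e x)) ->
    (img a = d @*^-1 img b :> {set G})%g ->
    forall x, pull d (push b x) = push a (pull e x)
}.

Section InductionInflation.
Variables (R : comPzRingType) (M : finGroupType -> lmodType R) (F : mfi M).
Variable G : finGroupType.

Definition ind (H : {group G}) : {linear M (subg_of H) -> M G} :=
  push F (incl H).

Definition infl (N : normal_subgroup G) :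
    {linear M (coset_of N) -> M G} :=
  pull F (quo_hom N).

(** Only the components of [y] at the proper subgroups of [G] are used. *)
Definition ind_sum (y : forall H : {group G}, M (subg_of H)) : M G :=
  \sum_(H : {group G} | (H \proper [set: G])%g) ind H (y H).

(** [x] belongs to the sum of the images of the maps [ind H], that is, to
    [I_M(G)]. *)
Definition ind_part (x : M G) : Prop := exists y, x = ind_sum y.

Definition primordial : Prop :=
  [set: G]%g = 1%g \/ ~ (forall x : M G, ind_part x).

Definition infl_sum (z : forall N : normal_subgroup G, M (coset_of N)) :
    M G :=
  \sum_(N : normal_subgroup G | nsub_group N != 1%G) infl N (z N).

Definition imprim : {pred M G} := fun x =>
  `[< exists y z, x = ind_sum y + infl_sum z >].

Fact imprim_submod_closed : submod_closed imprim.
Proof.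
split.
  apply/asboolP; exists (fun=> 0), (fun=> 0).
  by rewrite /ind_sum /infl_sum !big1 ?addr0 // => i _; rewrite linear0.
move=> c u v /asboolP[y [z ->]] /asboolP[y' [z' ->]]; apply/asboolP.
exists (fun H => c *: y H + y' H), (fun N => c *: z N + z' N).
rewrite scalerDr addrACA; congr (_ + _); rewrite scaler_sumr -big_split.
  by apply: eq_bigr => H _; rewrite linearP.
by apply: eq_bigr => N _; rewrite linearP.
Qed.

HB.instance Definition _ :=
  GRing.isSubmodClosed.Build R (M G) imprim imprim_submod_closed.

Definition Prim : lmodType R := quot_mod imprim.

End InductionInflation.

Arguments imprim {R M} F {G}.

Record sub_mfi (R : comPzRingType) (M : finGroupType -> lmodType R)
    (F : mfi M) := SubMFI {
  sub_mfi_pred : forall G : finGroupType, submodClosed (M G);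
  sub_mfi_push : forall (H G : finGroupType) (a : mono H G) x,
    x \in sub_mfi_pred H -> push F a x \in sub_mfi_pred G;
  sub_mfi_pull : forall (H G : finGroupType) (a : hom H G) x,
    x \in sub_mfi_pred G -> pull F a x \in sub_mfi_pred H
}.

Section SubMFI.
Variables (R : comPzRingType) (M : finGroupType -> lmodType R) (F : mfi M).
Variable S : sub_mfi F.

Definition sub_mfi_obj (G : finGroupType) : lmodType R :=
  sub_mod (sub_mfi_pred S G).

Definition mfi_of_sub : mfi sub_mfi_obj.
Proof.
refine (@MFI R sub_mfi_obj
  (fun H G a => restrict_lin (fun u => @sub_mfi_push _ _ _ S H G a u))
  (fun H G a => restrict_lin (fun u => @sub_mfi_pull _ _ _ S H G a u))
  _ _ _ _ _ _ _).
- by move=> H K G a b x; apply: val_inj; rewrite /= push_comp.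
- by move=> H K G a b x; apply: val_inj; rewrite /= pull_comp.
- by move=> G g x; apply: val_inj; rewrite /= pull_inner.
- by move=> G g x; apply: val_inj; rewrite /= push_inner.
- by move=> G a b ab ba x; apply: val_inj; rewrite /= (push_aut F ab ba).
- move=> H K G a b X trX x; apply: val_inj.
  by rewrite raddf_sum /= (mackey F trX).
- move=> H H' G G' e d a b epe epd sq cart x; apply: val_inj => /=.
  exact: pull_push_cartesian.
Defined.

End SubMFI.

Section Tensor.
Variables (R S : comPzRingType) (phi : {rmorphism R -> S}) (V : lmodType R).

(** [S \otimes_R V], where [S] is an [R]-algebra through [phi], is the quotient
    of the set of formal sums [s_1 # v_1 + ... + s_n # v_n], encoded as lists
    of pairs, by the congruence generated by commutativity, biadditivity and
    [R]-balancedness. *)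
Inductive tens_rel : seq (S * V) -> seq (S * V) -> Prop :=
| tens_refl s : tens_rel s s
| tens_sym s t : tens_rel s t -> tens_rel t s
| tens_trans s t u : tens_rel s t -> tens_rel t u -> tens_rel s u
| tens_cat s s' t t' :
    tens_rel s s' -> tens_rel t t' -> tens_rel (s ++ t) (s' ++ t')
| tens_comm s t : tens_rel (s ++ t) (t ++ s)
| tens_0l v : tens_rel [:: (0, v)] [::]
| tens_Dl a b v : tens_rel [:: (a + b, v)] [:: (a, v); (b, v)]
| tens_Dr a u v : tens_rel [:: (a, u + v)] [:: (a, u); (a, v)]
| tens_bal a r v : tens_rel [:: (a * phi r, v)] [:: (a, r *: v)].

Definition tens_relb (s t : seq (S * V)) : bool := `[< tens_rel s t >].

Fact tens_relb_equiv : equiv_class_of tens_relb.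
Proof.
split=> [s|s t|t s u].
- by apply/asboolP; apply: tens_refl.
- by apply/asboolP/asboolP => ?; apply: tens_sym.
- move=> /asboolP st /asboolP tu; apply/asboolP; exact: tens_trans st tu.
Qed.

Canonical tens_relb_equivRel := EquivRelPack tens_relb_equiv.

Definition tensor : Type := {eq_quot tens_relb}%qT.
HB.instance Definition _ := Choice.on tensor.
HB.instance Definition _ := EqQuotient.on tensor.

Definition tclass (s : seq (S * V)) : tensor := \pi_tensor%qT s.

Lemma tclassP s t : tclass s = tclass t <-> tens_rel s t.
Proof.
split=> [|st]; first by move=> /eqmodP/asboolP.
by apply/eqmodP/asboolP.
Qed.

Lemma tclass_surj (x : tensor) : exists s, tclass s = x.
Proof. by exists (repr x); rewrite /tclass reprK. Qed.

Section Map.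
Variable f : S * V -> S * V.
Hypothesis f_rel : forall s t, tens_rel s t -> tens_rel (map f s) (map f t).
Definition tmap (x : tensor) : tensor := tclass (map f (repr x)).
Lemma tmapE s : tmap (tclass s) = tclass (map f s).
Proof. by apply/tclassP/f_rel/tclassP; rewrite /tclass reprK. Qed.
End Map.

Lemma map_rel (a : S) s t : tens_rel s t ->
  tens_rel (map (fun p => (a * p.1, p.2)) s)
           (map (fun p => (a * p.1, p.2)) t).
Proof.
elim=> {s t} /= [s|s t _ st|s t u _ st _ tu|s s' t t' _ ss _ tt|s t|v|b c v
  |b u v|b r v]; rewrite ?map_cat ?mulr0 ?mulrDr ?mulrA.
- exact: tens_refl.
- exact: tens_sym.
- exact: tens_trans st tu.
- exact: tens_cat.
- exact: tens_comm.
- exact: tens_0l.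
- exact: tens_Dl.
- exact: tens_Dr.
- exact: tens_bal.
Qed.

Definition tadd (x y : tensor) : tensor := tclass (repr x ++ repr y).
Definition topp : tensor -> tensor := tmap (fun p => (-1 * p.1, p.2)).
Definition tscale (a : S) : tensor -> tensor :=
  tmap (fun p => (a * p.1, p.2)).

Lemma taddE s t : tadd (tclass s) (tclass t) = tclass (s ++ t).
Proof.
by apply/tclassP/tens_cat; apply/tclassP; rewrite /tclass reprK.
Qed.

Lemma tscaleE a s :
  tscale a (tclass s) = tclass (map (fun p => (a * p.1, p.2)) s).
Proof. exact/tmapE/map_rel. Qed.

Fact taddA : associative tadd.
Proof.
move=> x y z; have [s <-] := tclass_surj x; have [t <-] := tclass_surj y.
by have [u <-] := tclass_surj z; rewrite !taddE catA.
Qed.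

Fact taddC : commutative tadd.
Proof.
move=> x y; have [s <-] := tclass_surj x; have [t <-] := tclass_surj y.
by rewrite !taddE; apply/tclassP/tens_comm.
Qed.

Fact tadd0 : left_id (tclass [::]) tadd.
Proof. by move=> x; have [s <-] := tclass_surj x; rewrite taddE. Qed.

Fact tscaleDl a b x : tscale (a + b) x = tadd (tscale a x) (tscale b x).
Proof.
have [s <-] := tclass_surj x; rewrite !tscaleE taddE; apply/tclassP.
elim: s => [|[c v] s IHs] /=; first exact: tens_refl.
rewrite mulrDl -cat1s.
apply: tens_trans (tens_cat (tens_Dl (a * c) (b * c) v) IHs) _ => /=.
rewrite -(cat1s (a * c, v)) -[X in tens_rel _ X](cat1s (a * c, v)).
apply: tens_cat (tens_refl _) _; rewrite -cat1s catA.
rewrite -[X in tens_rel _ (_ ++ X)]cat1s catA.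
exact: tens_cat (tens_comm _ _) (tens_refl _).
Qed.

Fact tscale0 x : tscale 0 x = tclass [::].
Proof.
have [s <-] := tclass_surj x; rewrite !tscaleE; apply/tclassP.
elim: s => [|[c v] s IHs] /=; first exact: tens_refl.
by rewrite mul0r; apply: (tens_cat (tens_0l v) IHs).
Qed.

Fact tscale1 : left_id 1 tscale.
Proof.
move=> x; have [s <-] := tclass_surj x; rewrite !tscaleE.
by rewrite map_id_in // => -[c v] _ /=; rewrite mul1r.
Qed.

Fact taddN : left_inverse (tclass [::]) topp tadd.
Proof.
move=> x; rewrite -{2}[x]tscale1 -[topp x]/(tscale (-1) x) -tscaleDl.
by rewrite addNr tscale0.
Qed.

HB.instance Definition _ :=
  GRing.isZmodule.Build tensor taddA taddC tadd0 taddN.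

Fact tscaleA a b x : tscale a (tscale b x) = tscale (a * b) x.
Proof.
have [s <-] := tclass_surj x; rewrite !tscaleE -map_comp; congr tclass.
by apply: eq_map => -[c v] /=; rewrite mulrA.
Qed.

Fact tscaleDr : right_distributive tscale +%R.
Proof.
move=> a x y; have [s <-] := tclass_surj x; have [t <-] := tclass_surj y.
by rewrite -[_ + _]/(tadd _ _) taddE !tscaleE map_cat -taddE.
Qed.

HB.instance Definition _ := GRing.Zmodule_isLmodule.Build S tensor
  tscaleA tscale1 tscaleDr (fun x a b => tscaleDl a b x).

Definition tens (a : S) (v : V) : tensor := tclass [:: (a, v)].

Lemma tclassE s : tclass s = \sum_(p <- s) tens p.1 p.2.
Proof.
elim: s => [|[a v] s IHs]; first by rewrite big_nil.
by rewrite big_cons -IHs -[RHS]/(tadd _ _) taddE.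
Qed.

Lemma tensDr a u v : tens a (u + v) = tens a u + tens a v.
Proof. by rewrite -[RHS]/(tadd _ _) taddE; apply/tclassP/tens_Dr. Qed.

Lemma tens_bilin a r v : tens (a * phi r) v = tens a (r *: v).
Proof. exact/tclassP/tens_bal. Qed.

Lemma tensr0 a : tens a 0 = 0.
Proof. by apply: (addrI (tens a 0)); rewrite -tensDr !addr0. Qed.

Lemma tens_sum a (I : Type) (s : seq I) (P : pred I) (v : I -> V) :
  tens a (\sum_(i <- s | P i) v i) = \sum_(i <- s | P i) tens a (v i).
Proof. exact: (big_morph _ (tensDr a) (tensr0 a)). Qed.

End Tensor.

Section TensorMap.
Variables (R S : comPzRingType) (phi : {rmorphism R -> S}).
Variables (U V : lmodType R) (f : {linear U -> V}).

Lemma tens_map_rel s t : tens_rel phi s t ->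
  tens_rel phi (map (fun p => (p.1, f p.2)) s) (map (fun p => (p.1, f p.2)) t).
Proof.
elim=> {s t} /= [s|s t _ st|s t u _ st _ tu|s s' t t' _ ss _ tt|s t|v|b c v
  |b u v|b r v]; rewrite ?map_cat ?linearD ?linearZ.
- exact: tens_refl.
- exact: tens_sym.
- exact: tens_trans st tu.
- exact: tens_cat.
- exact: tens_comm.
- exact: tens_0l.
- exact: tens_Dl.
- exact: tens_Dr.
- exact: tens_bal.
Qed.

(** [id_S \otimes f] *)
Definition tens_map (x : tensor phi U) : tensor phi V :=
  tclass phi (map (fun p => (p.1, f p.2)) (repr x)).

Lemma tens_mapE s :
  tens_map (tclass phi s) = tclass phi (map (fun p => (p.1, f p.2)) s).
Proof.
by apply/tclassP/tens_map_rel/tclassP; rewrite /tclass reprK.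
Qed.

Lemma tens_map_is_linear : linear tens_map.
Proof.
move=> a x y; have [s <-] := tclass_surj x; have [t <-] := tclass_surj y.
rewrite -[a *: _]/(tscale _ _) tscaleE -[_ + _]/(tadd _ _) taddE !tens_mapE.
rewrite -[a *: _]/(tscale _ _) tscaleE -[_ + _ in RHS]/(tadd _ _) taddE.
by rewrite map_cat -!map_comp.
Qed.

HB.instance Definition _ :=
  GRing.isLinear.Build S (tensor phi U) (tensor phi V) *:%R tens_map
    tens_map_is_linear.

Lemma tens_map_tens a u : tens_map (tens phi a u) = tens phi a (f u).
Proof. exact: tens_mapE. Qed.

End TensorMap.

Arguments tens_map {R S} phi {U V} f.

Section BaseChange.
Variables (R S : comPzRingType) (phi : {rmorphism R -> S}).
Variables (M : finGroupType -> lmodType R) (F : mfi M).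

Definition base_change_obj (G : finGroupType) : lmodType S := tensor phi (M G).

(** The underlying MFI of [F_S], which is all that [primordial] depends on when
    [F] is a GFI. *)
Definition base_change : mfi base_change_obj.
Proof.
refine (@MFI S base_change_obj
  (fun H G a => tens_map phi (push F a))
  (fun H G a => tens_map phi (pull F a))
  _ _ _ _ _ _ _).
- move=> H K G a b x; have [s <-] := tclass_surj x.
  rewrite /= !tens_mapE -map_comp; congr tclass.
  by apply: eq_map => p /=; rewrite push_comp.
- move=> H K G a b x; have [s <-] := tclass_surj x.
  rewrite /= !tens_mapE -map_comp; congr tclass.
  by apply: eq_map => p /=; rewrite pull_comp.
- move=> G g x; have [s <-] := tclass_surj x; rewrite /= tens_mapE.
  by rewrite map_id_in // => -[c v] _ /=; rewrite pull_inner.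
- move=> G g x; have [s <-] := tclass_surj x; rewrite /= tens_mapE.
  by rewrite map_id_in // => -[c v] _ /=; rewrite push_inner.
- move=> G a b ab ba x; have [s <-] := tclass_surj x; rewrite /= !tens_mapE.
  congr tclass; apply: eq_map => p.
  by rewrite (push_aut F ab ba).
- move=> H K G a b X trX x; have [s <-] := tclass_surj x.
  rewrite tclassE; under [RHS]eq_bigr do rewrite !linear_sum.
  rewrite !linear_sum exchange_big /=; apply: eq_bigr => -[c v] _ /=.
  rewrite !tens_map_tens (mackey F trX) tens_sum; apply: eq_bigr => g _.
  by rewrite !tens_map_tens.
- move=> H H' G G' e d a b epe epd sq cart x; have [s <-] := tclass_surj x.
  rewrite /= !tens_mapE -!map_comp; congr tclass; apply: eq_map => p /=.
  by rewrite (pull_push_cartesian F epe epd sq cart).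
Defined.

End BaseChange.

Definition alg_family (R : comPzRingType) (A : finGroupType -> ralgType R)
  (G : finGroupType) : lmodType R := ralg_lmod (A G).

Record gfi (R : comPzRingType) := GFI {
  gfi_obj :> finGroupType -> ralgType R;
  gfi_mfi :> mfi (alg_family gfi_obj);
  pull_monoid : forall (H G : finGroupType) (a : hom H G),
    monoid_morphism (pull gfi_mfi a : gfi_obj G -> gfi_obj H);
  frobenius_l : forall (H G : finGroupType) (a : mono H G)
      (x : gfi_obj H) (y : gfi_obj G),
    (push gfi_mfi a x : gfi_obj G) * y =
      push gfi_mfi a (x * (pull gfi_mfi a y : gfi_obj H));
  frobenius_r : forall (H G : finGroupType) (a : mono H G)
      (x : gfi_obj H) (y : gfi_obj G),
    y * (push gfi_mfi a x : gfi_obj G) =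
      push gfi_mfi a ((pull gfi_mfi a y : gfi_obj H) * x)
}.

Record gfi_morphism (R : comPzRingType) (F E : gfi R) := GFIMorphism {
  gfi_mor : forall G : finGroupType,
    {linear alg_family F G -> alg_family E G};
  gfi_mor_monoid : forall G : finGroupType,
    monoid_morphism (gfi_mor G : F G -> E G);
  gfi_mor_push : forall (H G : finGroupType) (a : mono H G) x,
    gfi_mor G (push F a x) = push E a (gfi_mor H x);
  gfi_mor_pull : forall (H G : finGroupType) (a : hom H G) x,
    gfi_mor H (pull F a x) = pull E a (gfi_mor G x)
}.

Section KernelImage.
Variables (R : comPzRingType) (F E : gfi R) (m : gfi_morphism F E).

Section Carriers.
Variable G : finGroupType.

Definition ker_pred : {pred alg_family F G} := fun x => gfi_mor m G x == 0.

Fact ker_submod_closed : submod_closed ker_pred.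
Proof.
split=> [|a x y /eqP x0 /eqP y0]; apply/eqP.
  exact: linear0.
by rewrite linearP x0 y0 scaler0 addr0.
Qed.

HB.instance Definition _ :=
  GRing.isSubmodClosed.Build R (alg_family F G) ker_pred ker_submod_closed.

Definition im_pred : {pred alg_family E G} :=
  fun y => `[< exists x, y = gfi_mor m G x >].

Fact im_submod_closed : submod_closed im_pred.
Proof.
split=> [|a _ _ /asboolP[x ->] /asboolP[y ->]]; apply/asboolP.
  by exists 0; rewrite linear0.
by exists (a *: x + y); rewrite linearP.
Qed.

HB.instance Definition _ :=
  GRing.isSubmodClosed.Build R (alg_family E G) im_pred im_submod_closed.

End Carriers.

Definition kernel_sub : sub_mfi F.
Proof.
refine (@SubMFI R _ F (fun G => @ker_pred G) _ _) => H G a x /eqP x0.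
- by apply/eqP; rewrite gfi_mor_push x0 linear0.
- by apply/eqP; rewrite gfi_mor_pull x0 linear0.
Defined.

Definition gfi_kernel : mfi (sub_mfi_obj kernel_sub) := mfi_of_sub kernel_sub.

Definition image_sub : sub_mfi E.
Proof.
refine (@SubMFI R _ E (fun G => @im_pred G) _ _) => H G a _ /asboolP[x ->].
- by apply/asboolP; exists (push F a x); rewrite gfi_mor_push.
- by apply/asboolP; exists (pull F a x); rewrite gfi_mor_pull.
Defined.

(** The underlying MFI of the GFI [Im m]. *)
Definition gfi_image : mfi (sub_mfi_obj image_sub) := mfi_of_sub image_sub.

End KernelImage.

Arguments ker_pred {R F E} m {G}.
Arguments im_pred {R F E} m {G}.

Section QuotientIdeal.
Variables (R : comPzRingType) (F E : gfi R) (m : gfi_morphism F E).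
Variable G : finGroupType.

Definition quotient_scalar (a : R) : Prop :=
  exists N : normal_subgroup G, nsub_group N != 1%G /\
    exists2 y : F (coset_of N),
      ind_part F y & a *: (1 : F (coset_of N)) + y \in ker_pred m.

Definition quotient_ideal : {pred R^o} :=
  lin_span (quotient_scalar : R^o -> Prop).

HB.instance Definition _ := GRing.SubmodClosed.on quotient_ideal.

End QuotientIdeal.

(* Main.v *)
Require Import Defs.
From HB Require Import structures.
From mathcomp Require Import ssreflect ssrfun ssrbool eqtype ssrnat seq choice.
From mathcomp Require Import fintype bigop finset.
From mathcomp Require Import fingroup morphism automorphism quotient.
From mathcomp Require Import ssralg generic_quotient ring_quotient fraction.
From mathcomp Require Import boolp.

Set Implicit Arguments.
Unset Strict Implicit.
Unset Printing Implicit Defensive.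

Import GRing.Theory.
Local Open Scope ring_scope.

(** The idea is to split off the coefficient of the unit.

    Write [I(G)] for [ind_part F] at [G].  Every element of [F(G)] is [a 1 + u]
    with [u] in [I(G)], and the scalar [a] is unique: the Frobenius relations
    make [I(G)] an ideal, so if a nonzero multiple of [1] lay in it, then over
    the fraction field all of [F_Q(G)] would be induced from proper subgroups,
    against primordiality ([primordial_scalar_part0]).  Taking scalar parts is
    therefore an [R]-linear map from [F(G)] to [R] with kernel [I(G)].

    Restrict it to [K(G)].  It is onto, because non-primordiality of the image
    writes [m 1] as a sum of inductions of elements [m x_H], so that
    [x = 1 - sum of Ind x_H] is in [K(G)] ([kernel_one_plus_ind_exists]).  Its
    kernel consists of sums of inductions of elements of the [K(H)]: if [z] is
    in both [K(G)] and [I(G)], then [z = z x - z (x - 1)], and the Frobenius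
    relations move the factor lying in [K] inside the inductions
    ([kernel_ind_part_imprim]).  Finally, inflation along a quotient map sends
    [1] to [1] and [I(G/N)] to [I(G)] ([ind_part_pull_epi]), hence preserves
    scalar parts, so the image of [Imprim_K(G)] under the scalar part is exactly
    the ideal of the theorem.

    It follows that [Prim_K(G)] is generated by the class of any such [x]
    ([Prim_cyclic]), with the ideal as the annihilator of that class
    ([Prim_annihilator]); a cyclic module is the quotient of the ring by the
    annihilator of a generator ([cyclic_module_quotient]). *)

(** * Cyclic modules and linear spans *)

(** The isomorphism sends [p] to the class of any scalar [a] with [p = a *: v];
    that class does not depend on the choice since [J] annihilates [v]. *)
Lemma cyclic_module_quotient (R : pzRingType) (V : lmodType R) (v : V)
    (J : submodClosed R^o) :
  (forall p : V, exists a : R, p = a *: v) ->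
  (forall a : R, a *: v = 0 <-> (a : R^o) \in J) ->
  exists f : {linear V -> quot_mod J}, bijective f.
Proof.
move=> genV annJ.
pose c p : R^o := sval (cid (genV p)).
have cE p : p = (c p : R) *: v by rewrite /c; case: cid.
have eqJ (a b : R) : a *: v = b *: v <-> quot_pi J a = quot_pi J b.
  rewrite quot_pi_eq -annJ scalerBl.
  by split=> [->|/subr0_eq //]; rewrite subrr.
pose f p := quot_pi J (c p).
have f_lin : linear f.
  move=> a p q; rewrite /f -[a *: quot_pi J _]/(quot_scale a _).
  rewrite quot_scale_pi -quot_piD.
  by apply/eqJ; rewrite -cE scalerDl -scalerA -!cE.
pose g r := (repr (r : Quotient.quot (submod_pred J)) : R) *: v.
pose fL := GRing.isLinear.Build R V (quot_mod J) *:%R f f_lin.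
pose F : {linear V -> quot_mod J} := HB.pack f fL.
exists F, g => [p | r].
  by rewrite [RHS]cE; apply/eqJ; rewrite /F /= /f /quot_pi reprK.
have [a <-] := quot_pi_surj r.
by apply/eqJ; rewrite -cE; apply/eqJ; rewrite /quot_pi reprK.
Qed.

Lemma lin_span_ind (R : pzRingType) (V : lmodType R) (S T : V -> Prop) :
  T 0 -> (forall (a : R) u v, S u -> T v -> T (a *: u + v)) ->
  forall v, v \in lin_span S -> T v.
Proof.
move=> T0 TS v /asboolP[s sS ->]; elim: s sS => [|p s IHs] sS.
  by rewrite big_nil.
rewrite big_cons; apply: TS; first by apply: sS; rewrite mem_head.
by apply: IHs => q sq; apply: sS; rewrite in_cons sq orbT.
Qed.

(** * The submodule induced from proper subgroups *)

Lemma img_incl (G : finGroupType) (H : {group G}) :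
  img (incl H) = H :> {set G}.
Proof. exact: im_sgval. Qed.

Section InducedPart.
Variables (R : comPzRingType) (M : finGroupType -> lmodType R) (F : mfi M).
Implicit Type G : finGroupType.

Lemma ind_part_linear G (a : R) (u v : M G) :
  ind_part F u -> ind_part F v -> ind_part F (a *: u + v).
Proof.
move=> [y ->] [y' ->]; exists (fun H => a *: y H + y' H).
rewrite /ind_sum scaler_sumr -big_split.
by apply: eq_bigr => H _; rewrite linearP.
Qed.

Lemma ind_part0 G : ind_part F (0 : M G).
Proof.
by exists (fun=> 0); rewrite /ind_sum big1 // => H _; rewrite linear0.
Qed.

Lemma ind_partD G (u v : M G) :
  ind_part F u -> ind_part F v -> ind_part F (u + v).
Proof. by rewrite -{2}[u]scale1r; apply: ind_part_linear. Qed.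

Lemma ind_partZ G (a : R) (u : M G) : ind_part F u -> ind_part F (a *: u).
Proof.
move=> Iu; rewrite -[_ *: _]addr0; apply: ind_part_linear => //.
exact: ind_part0.
Qed.

Lemma ind_partB G (u v : M G) :
  ind_part F u -> ind_part F v -> ind_part F (u - v).
Proof.
by move=> Iu Iv; apply: ind_partD; rewrite // -scaleN1r; apply: ind_partZ.
Qed.

Lemma ind_part_sum G (I : Type) (s : seq I) (P : pred I) (f : I -> M G) :
  (forall i, P i -> ind_part F (f i)) -> ind_part F (\sum_(i <- s | P i) f i).
Proof.
by move=> If; elim/big_ind: _ => //; [apply: ind_part0 | apply: ind_partD].
Qed.

Lemma ind_part_ind G (H : {group G}) (x : M (subg_of H)) :
  (H \proper [set: G])%g -> ind_part F (ind F H x).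
Proof.
move=> prH.
(* The family equal to [x] at [H] and to [0] at the other subgroups. *)
exists (dfwith (fun K : {group G} => 0 : M (subg_of K)) x).
rewrite /ind_sum (bigD1 H) //= dfwith_in big1 ?addr0 // => K /andP[_ KH].
by rewrite dfwith_out ?linear0 // eq_sym.
Qed.

Section EpiPullback.
Variables (G G' : finGroupType) (d : hom G G') (H : {group G'}).

Let D : {group G} := (d @*^-1 H)%G.

Fact epi_restrictM :
  {in [set: subg_of D] &,
    {morph (fun x : subg_of D => subg H (d (sgval x))) : x y / (x * y)%g}}.
Proof.
have dH (x : subg_of D) : d (sgval x) \in H.
  by have := subgP x; rewrite inE => /andP[_]; rewrite inE.
by move=> x y _ _; rewrite /= morphM ?inE // subgM.
Qed.

Definition epi_restrict : hom (subg_of D) (subg_of H) := Morphism epi_restrictM.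

Lemma sgval_epi_restrict x : sgval (epi_restrict x) = d (sgval x).
Proof.
by rewrite subgK //; have := subgP x; rewrite inE => /andP[_]; rewrite inE.
Qed.

(** The square formed by [d], its restriction to [D] and the two inclusions is
    cartesian, since [D] is the whole preimage of [H]. *)
Lemma pull_ind_epi (x : M (subg_of H)) : epi d ->
  pull F d (ind F H x) = ind F D (pull F epi_restrict x).
Proof.
move=> epid; apply: pull_push_cartesian => //.
- apply/setP => h; rewrite inE.
  have : sgval h \in (d @* [set: G])%g by rewrite epid inE.
  case/morphimP => g _ _ hg.
  have gD : g \in D by rewrite !inE -hg subgP.
  apply/morphimP; exists (subg D g); rewrite ?inE //.
  by apply: val_inj; rewrite [RHS]sgval_epi_restrict subgK.
- by move=> g; rewrite -[RHS]/(sgval (epi_restrict g)) sgval_epi_restrict.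
- by rewrite !img_incl.
Qed.

Lemma preim_proper : epi d -> (H \proper [set: G'])%g -> (D \proper [set: G])%g.
Proof.
rewrite !properT => epid; apply: contraNneq => DT.
apply/eqP/setP => h; rewrite inE.
have : h \in (d @* [set: G])%g by rewrite epid inE.
case/morphimP => g _ _ ->.
by have: g \in (D : {set G}) by [rewrite DT inE]; rewrite !inE.
Qed.

End EpiPullback.

(** By [pull_ind_epi], as preimages of proper subgroups under an epimorphism
    are proper. *)
Lemma ind_part_pull_epi (G G' : finGroupType) (d : hom G G') (x : M G') :
  epi d -> ind_part F x -> ind_part F (pull F d x).
Proof.
move=> epid [y ->]; rewrite /ind_sum linear_sum; apply: ind_part_sum => H prH.
by rewrite pull_ind_epi //; apply/ind_part_ind/preim_proper.
Qed.

Lemma quo_hom_epi G (N : normal_subgroup G) : epi (quo_hom N).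
Proof.
have nN := normal_norm (valP N).
apply/setP => x; rewrite inE.
case: (cosetP x) => g Ng ->; apply/morphimP; exists g; rewrite ?inE //.
Qed.

End InducedPart.

(** * Identification of a group with its quotient by the trivial subgroup *)

Lemma hom_ext (G H : finGroupType) (f g : hom G H) : f =1 g -> f = g.
Proof.
case: f g => [f fM] [g gM] /= /funext fg; move: fM gM.
by rewrite {}fg => fM gM; rewrite (Prop_irrelevance fM gM).
Qed.

Section BijectivePullback.
Variables (R : comPzRingType) (M : finGroupType -> lmodType R) (F : mfi M).
Variables (G G' : finGroupType) (d : hom G G').
Hypotheses (injd : ('injm d)%g) (epid : epi d).

Fact epi_invmM : {in [set: G'] &, {morph invm injd : x y / (x * y)%g}}.
Proof. by move=> x y _ _; rewrite morphM // epid inE. Qed.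

Lemma pull_bij_surj (x : M G) : exists w, pull F d w = x.
Proof.
exists (pull F (Morphism epi_invmM) x).
(* No axiom speaks of the identity, but it is conjugation by [1]. *)
rewrite -pull_comp -[RHS](pull_inner F 1%g); congr (pull F _ x).
by apply: hom_ext => g /=; rewrite invmE ?inE //; rewrite /conjgm conjg1.
Qed.

End BijectivePullback.

Definition trivial_nsub (G : finGroupType) : normal_subgroup G :=
  NormalSubgroup (normal1 [set: G]%G).

(** This transfers hypotheses on all quotients of [G] to [G] itself, which is
    isomorphic but not equal to its trivial quotient. *)
Lemma infl_trivial_surj (R : comPzRingType) (M : finGroupType -> lmodType R)
    (F : mfi M) (G : finGroupType) (x : M G) :
  exists w, infl F (trivial_nsub G) w = x.
Proof.
apply: pull_bij_surj; last exact: quo_hom_epi.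
apply/subsetP => g /morphpreP[_ /set1P g1].
have Ng : g \in ('N(1))%g by rewrite norm1 inE.
by rewrite (coset_idr Ng g1).
Qed.

(** * The induced ideal of a Green functor *)

Section GreenInduction.
Variables (R : comPzRingType) (F : gfi R) (G : finGroupType).

Lemma ralg_scaleAl (A : ralgType R) (a : R) (x y : A) :
  a *: x * y = a *: (x * y).
Proof. by rewrite -[LHS]/(ralg_scale _ _ * y) /ralg_scale -mulrA. Qed.

Lemma pull1 (H : finGroupType) (a : hom H G) :
  pull F a (1 : F G) = (1 : F H).
Proof. by have [] := pull_monoid F a. Qed.

Lemma ind_sum_mulr (y : forall H : {group G}, F (subg_of H)) (x : F G) :
  (ind_sum F y : F G) * x =
    ind_sum F (fun H => y H * (pull F (incl H) x : F (subg_of H))).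
Proof.
by rewrite /ind_sum mulr_suml; apply: eq_bigr => H _; apply: frobenius_l.
Qed.

Lemma ind_sum_mull (y : forall H : {group G}, F (subg_of H)) (x : F G) :
  x * (ind_sum F y : F G) =
    ind_sum F (fun H => (pull F (incl H) x : F (subg_of H)) * y H).
Proof.
by rewrite /ind_sum mulr_sumr; apply: eq_bigr => H _; apply: frobenius_r.
Qed.

(** Since [a *: v] is the product of [a *: 1] and [v], this is the Frobenius
    relation. *)
Lemma scalar_ind_part_annihilates (a : R) (v : F G) :
  ind_part F (a *: (1 : F G)) -> ind_part F (a *: v).
Proof.
move=> [y ay]; rewrite -[v]mul1r -ralg_scaleAl.
by rewrite ay ind_sum_mulr; eexists.
Qed.

End GreenInduction.

(** * Uniqueness of the scalar part *)

Lemma ind_part_tens (R S : comPzRingType) (phi : {rmorphism R -> S})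
    (M : finGroupType -> lmodType R) (F : mfi M) (G : finGroupType)
    (s : S) (v : M G) :
  ind_part F v -> ind_part (base_change phi F) (tens phi s v).
Proof.
move=> [y ->]; exists (fun H => tens phi s (y H)).
by rewrite tens_sum; apply: eq_bigr => H _; rewrite -tens_map_tens.
Qed.

(** If [a 1] is induced, then so is [a v] for every [v]; when [a] is invertible
    in the fraction field, [c # v = (c / a) # (a v)] is then induced as well, so
    that nothing in [F_Q(G)] is left outside of the induced part. *)
Lemma primordial_scalar_part0 (R : idomainType) (F : gfi R) (G : finGroupType)
    (a : R) :
  [set: G]%g <> 1%g -> primordial (base_change (@FracField.tofrac R) F) G ->
  ind_part F (a *: (1 : F G)) -> a = 0.
Proof.
move=> G1 [//|notI] Ia; apply/eqP/negP => /negP a0; apply: notI => q.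
have [s <-] := tclass_surj q; rewrite tclassE; apply: ind_part_sum => -[c v] _.
have -> : c = c / FracField.tofrac a * FracField.tofrac a.
  by rewrite divfK // tofrac_eq0.
by rewrite tens_bilin; apply/ind_part_tens/scalar_ind_part_annihilates.
Qed.

(** * Induced elements of the kernel *)

Section Kernel.
Variables (R : comPzRingType) (F E : gfi R) (m : gfi_morphism F E).
Variable G : finGroupType.

Lemma ker_predP (H : finGroupType) (x : F H) :
  reflect (gfi_mor m H x = 0) (x \in ker_pred m).
Proof. exact: eqP. Qed.

Lemma ker_mulr (H : finGroupType) (x y : F H) :
  x \in ker_pred m -> x * y \in ker_pred m.
Proof.
move=> /ker_predP x0; apply/ker_predP.
by have [_ ->] := gfi_mor_monoid m H; rewrite x0 mul0r.
Qed.

Lemma ker_mull (H : finGroupType) (x y : F H) :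
  y \in ker_pred m -> x * y \in ker_pred m.
Proof.
move=> /ker_predP y0; apply/ker_predP.
by have [_ ->] := gfi_mor_monoid m H; rewrite y0 mulr0.
Qed.

Lemma val_ind_sum_kernel
    (y : forall H : {group G}, sub_mfi_obj (kernel_sub m) (subg_of H)) :
  val (ind_sum (gfi_kernel m) y) = ind_sum F (fun H => val (y H)).
Proof. by rewrite /ind_sum raddf_sum. Qed.

(** Membership of [z] in the kernel and in the sum of the [Ind F(H)] is
    upgraded to membership in the sum of the [Ind K(H)]: both terms of
    [z = z * x - z * (x - 1)] have a factor in the kernel, namely [x] and [z],
    and a factor which is a sum of inductions.  By the Frobenius relations they
    are inductions of products containing a restriction of [x] or of [z]. *)
Lemma kernel_ind_part_imprim (x z : sub_mfi_obj (kernel_sub m) G)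
    (y : forall H : {group G}, F (subg_of H)) :
  sub_mod_val x = (1 : F G) + (ind_sum F y : F G) ->
  ind_part F (sub_mod_val z) -> z \in imprim (gfi_kernel m).
Proof.
case: x z => [x Kx] [z Kz] /= xE [u zE].
have zx : z = (z : F G) * x - (z : F G) * (ind_sum F y : F G).
  by rewrite xE mulrDr mulr1 addrK.
have Kv H : (u H * (pull F (incl H) x : F (subg_of H)) -
    (pull F (incl H) z : F (subg_of H)) * y H) \in ker_pred m.
  apply: rpredB; first exact/ker_mull/(sub_mfi_pull (s := kernel_sub m)).
  exact/ker_mulr/(sub_mfi_pull (s := kernel_sub m)).
apply/asboolP; exists (fun H => SubMod (Kv H)), (fun=> 0).
rewrite /infl_sum big1 ?addr0 => [|N _]; last exact: linear0.
apply: val_inj; rewrite val_ind_sum_kernel /= [LHS]zx {1}zE.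
rewrite ind_sum_mulr ind_sum_mull -sumrB.
by apply: eq_bigr => H _; rewrite linearB.
Qed.

(** The unit of the image is a sum of inductions of elements [m u_H];
    lift those elements and subtract them from the unit of [F]. *)
Lemma kernel_one_plus_ind_exists :
  ~ primordial (gfi_image m) G ->
  [set: G]%g <> 1%g /\
  exists (x : sub_mfi_obj (kernel_sub m) G)
      (y : forall H : {group G}, F (subg_of H)),
    sub_mod_val x = (1 : F G) + (ind_sum F y : F G).
Proof.
move=> /not_orP[G1 /contrapT allI]; split=> //.
have im1 : (1 : E G) \in im_pred m.
  by apply/asboolP; exists (1 : F G); have [] := gfi_mor_monoid m G.
have [y yE] := allI (SubMod im1).
have lift H : exists u, sub_mod_val (y H) = gfi_mor m (subg_of H) u.
  by case: (y H) => v /= /asboolP.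
pose u H : F (subg_of H) := - sval (cid (lift H)).
have Kx : (1 : F G) + (ind_sum F u : F G) \in ker_pred m.
  apply/ker_predP; rewrite linearD.
  have -> : gfi_mor m G (1 : F G) = (1 : E G) by have [] := gfi_mor_monoid m G.
  rewrite -[X in X + _]/(val (SubMod im1)) yE !raddf_sum -big_split big1 //.
  move=> H _ /=.
  rewrite gfi_mor_push -linearD linearN /u.
  by case: cid => v /= ->; rewrite subrr linear0.
by exists (SubMod Kx), u.
Qed.

End Kernel.

(** * Scalar parts *)

Section ScalarPart.
Variables (R : comPzRingType) (F : gfi R).

(** A relation rather than a function: existence depends on a generation
    hypothesis, and uniqueness on primordiality over the fraction field. *)
Definition scalar_part (G : finGroupType) (z : F G) (a : R) : Prop :=
  ind_part F (z - a *: (1 : F G)).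

Lemma scalar_part_exists (G : finGroupType) (z : alg_family F G) :
  z \in lin_span (fun w => ind_part F w \/ w = (1 : F G)) ->
  exists a, scalar_part z a.
Proof.
apply: (@lin_span_ind _ _ _ (fun z => exists a, scalar_part z a)) =>
  [|c u v Su [b Ib]].
  by exists 0; rewrite /scalar_part scale0r subr0; apply: ind_part0.
case: Su => [Iu | ->].
  by exists b; rewrite /scalar_part -addrA; apply: ind_part_linear.
by exists (c + b); rewrite /scalar_part scalerDl opprD addrACA subrr add0r.
Qed.

Lemma scalar_part_pull_epi (G G' : finGroupType) (d : hom G G') (z : F G') a :
  epi d -> scalar_part z a -> scalar_part (pull F d z : F G) a.
Proof.
move=> epid /(ind_part_pull_epi epid).
by rewrite linearB linearZ /= pull1.
Qed.

Lemma scalar_part_infl (G : finGroupType) (N : normal_subgroup G)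
    (z : F (coset_of N)) a :
  scalar_part z a -> scalar_part (infl F N z : F G) a.
Proof. by apply: scalar_part_pull_epi; apply: quo_hom_epi. Qed.

End ScalarPart.

(** * The primitive quotient as a cyclic module *)

Section PrimitiveQuotient.
Variables (R : comPzRingType) (F E : gfi R) (m : gfi_morphism F E).
Variable G : finGroupType.
Variables (x : sub_mfi_obj (kernel_sub m) G).
Variable y : forall H : {group G}, F (subg_of H).
Hypothesis xE : sub_mod_val x = (1 : F G) + (ind_sum F y : F G).
Hypothesis split_quotient : forall (N : normal_subgroup G)
  (z : F (coset_of N)), exists a, scalar_part z a.

(** The element [z - a *: x] of the kernel has scalar part [0]. *)
Lemma imprim_sub_scalar_part (z : sub_mfi_obj (kernel_sub m) G) (a : R) :
  scalar_part (sub_mod_val z) a -> z - a *: x \in imprim (gfi_kernel m).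
Proof.
move=> Iz; apply: (kernel_ind_part_imprim xE).
rewrite -[sub_mod_val _]/(sub_mod_val z - a *: sub_mod_val x) xE.
rewrite scalerDr opprD addrA; apply: ind_partB => //.
by apply: ind_partZ; exists y.
Qed.

Lemma scalar_part_total (z : F G) : exists a, scalar_part z a.
Proof.
have [w <-] := infl_trivial_surj F z.
by have [a Ia] := split_quotient w; exists a; apply: scalar_part_infl.
Qed.

Lemma Prim_cyclic (p : Prim (gfi_kernel m) G) :
  exists a : R, p = a *: quot_pi (imprim (gfi_kernel m)) x.
Proof.
have [z <-] := quot_pi_surj p.
have [a Ia] := scalar_part_total (sub_mod_val z); exists a.
rewrite -[RHS]/(quot_scale a _) quot_scale_pi.
exact/quot_pi_eq/imprim_sub_scalar_part.
Qed.

Lemma infl_imprim (N : normal_subgroup G)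
    (w : sub_mfi_obj (kernel_sub m) (coset_of N)) :
  nsub_group N != 1%G -> infl (gfi_kernel m) N w \in imprim (gfi_kernel m).
Proof.
move=> N1; apply/asboolP.
pose z := dfwith (fun K : normal_subgroup G =>
  0 : sub_mfi_obj (kernel_sub m) (coset_of K)) w.
exists (fun=> 0), z.
rewrite /ind_sum big1 ?add0r => [|H _]; last exact: linear0.
rewrite /infl_sum (bigD1 N) //= /z dfwith_in big1 ?addr0 // => K /andP[_ KN].
by rewrite dfwith_out ?linear0 // eq_sym.
Qed.

(** A generator [b] of the ideal is the scalar part of an element [w] of the
    kernel at a proper quotient; then [b *: x] and the inflation of [w] have the
    same scalar part, so they agree modulo [Imprim]. *)
Lemma quotient_ideal_annihilates (a : R) :
  (a : R^o) \in quotient_ideal m G -> a *: x \in imprim (gfi_kernel m).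
Proof.
move=> aJ; apply: (@lin_span_ind _ R^o (quotient_scalar m G)
  (fun b => (b : R) *: x \in imprim (gfi_kernel m)) _ _ a aJ).
  by rewrite scale0r rpred0.
move=> c b b' [N [N1 [v Iv Kv]]] Ib'.
rewrite scalerDl rpredD // -scalerA rpredZ //.
pose w : sub_mfi_obj (kernel_sub m) (coset_of N) := SubMod Kv.
rewrite -[b *: x](subKr (infl (gfi_kernel m) N w)) rpredB ?infl_imprim //.
apply/imprim_sub_scalar_part/scalar_part_infl.
by rewrite /scalar_part addrAC subrr add0r.
Qed.

Hypothesis scalar_free : forall a : R,
  ind_part F (a *: (1 : F G)) -> a = 0.

(** Compare scalar parts in [a *: x = ind_sum u + infl_sum z]: on the left it is
    [a], on the right it is the sum of the scalar parts of the [z N], each of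
    which lies in the ideal. *)
Lemma annihilator_in_quotient_ideal (a : R) :
  a *: x \in imprim (gfi_kernel m) -> (a : R^o) \in quotient_ideal m G.
Proof.
move=> /asboolP[u [z axE]].
have [b bE] := choice (fun N => split_quotient (sub_mod_val (z N))).
have -> : a = \sum_(N : normal_subgroup G | nsub_group N != 1%G) b N.
  apply/subr0_eq/scalar_free; rewrite scalerBl scaler_suml.
  have -> : a *: (1 : F G) = sub_mod_val (a *: x) - a *: (ind_sum F y : F G).
    by rewrite -[sub_mod_val _]/(a *: sub_mod_val x) xE scalerDr addrK.
  rewrite axE -[sub_mod_val _]/(val (ind_sum (gfi_kernel m) u) +
    val (infl_sum (gfi_kernel m) z)) val_ind_sum_kernel.
  rewrite -addrA -addrA; apply: ind_partD; first by eexists.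
  rewrite addrCA addrC; apply: ind_partB; last by apply: ind_partZ; exists y.
  rewrite raddf_sum -sumrB; apply: ind_part_sum => N _.
  exact/scalar_part_infl/bE.
apply: rpred_sum => N N1; apply/asboolP; exists [:: (1, b N : R^o)].
  move=> _ /[!inE]/eqP-> /=; exists N; split=> //.
  exists (sub_mod_val (z N) - b N *: (1 : F (coset_of N))); first exact: bE.
  by rewrite addrC subrK; case: (z N).
by rewrite big_seq1 scale1r.
Qed.

Lemma Prim_annihilator (a : R) :
  a *: quot_pi (imprim (gfi_kernel m)) x = 0 <->
  (a : R^o) \in quotient_ideal m G.
Proof.
rewrite -[a *: quot_pi _ x]/(quot_scale a _) quot_scale_pi.
have -> : (0 : Prim (gfi_kernel m) G) = quot_pi (imprim (gfi_kernel m)) 0.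
  by apply: (addrI (quot_pi _ 0)); rewrite -quot_piD !addr0.
rewrite quot_pi_eq subr0; split; first exact: annihilator_in_quotient_ideal.
exact: quotient_ideal_annihilates.
Qed.

End PrimitiveQuotient.

Theorem theorem4p9 (R : idomainType) (F E : gfi R) (m : gfi_morphism F E)
    (G : finGroupType)
    (R_euclidean : euclidean_domain R)
    (F_torsion_free : forall H : finGroupType, torsion_free (alg_family F H))
    (F_inf_inj : forall N : normal_subgroup G, injective (infl F N))
    (F_generated : forall (N : normal_subgroup G)
       (z : alg_family F (coset_of N)),
       z \in lin_span (fun w : alg_family F (coset_of N) =>
                     ind_part F w \/ w = (1 : F (coset_of N))))
    (G_primordial :
       primordial (base_change (@FracField.tofrac R) F) G)
    (G_not_primordial : ~ primordial (gfi_image m) G) :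
  (exists f : {linear Prim (gfi_kernel m) G -> quot_mod (quotient_ideal m G)},
     bijective f) /\
  (forall (x : sub_mfi_obj (kernel_sub m) G)
     (y : forall H : {group G}, F (subg_of H)),
     sub_mod_val x = (1 : F G) + (ind_sum F y : F G) ->
     forall p : Prim (gfi_kernel m) G,
       p \in lin_span (fun q => q = quot_pi (imprim (gfi_kernel m)) x)).
Proof.
have split_quotient N z := scalar_part_exists (F_generated N z).
have [G1 [x [y xE]]] := kernel_one_plus_ind_exists G_not_primordial.
split; last first.
  move=> {y xE} x' y xE p; have [a ->] := Prim_cyclic xE split_quotient p.
  apply/asboolP; exists [:: (a, quot_pi (imprim (gfi_kernel m)) x')].
    by move=> _ /[!inE]/eqP->.
  by rewrite big_seq1.
have scalar_free a := @primordial_scalar_part0 R F G a G1 G_primordial.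
apply: (cyclic_module_quotient (Prim_cyclic xE split_quotient)).
exact: Prim_annihilator xE split_quotient scalar_free.
Qed.
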